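(* Let $\Phi:\mathbb{X}\to\overline{\mathbb{R}}$ be proper, lower semicontinuous and bounded from below, let $m\in\mathbb{N}$, $a>0$, and let $\{x^k\}_{k\in\mathbb{N}}\subset{\rm dom}\,\Phi$. If there exist an integer $k_1>m$ and $\overline{b}>0$ such that $$\Phi(x^{k+1})-\Phi(x^k)\le\frac{\overline{b}}{2}\|x^{k+1}-x^k\|^2\quad\text{for all }k\ge k_1,$$ then there exist $\tau\in(0,1)$, $\mu>0$ and an integer $\overline{k}>m$ such that for each $k\ge\overline{k}$ and every integer $i$ with $\ell(k-1)+1\le i\le\ell(k)-1$, $$\sqrt{\Phi(x^{\ell(k)})-\Phi(x^i)}\le\tau\sqrt{a}\,\|x^i-x^{i-1}\|+\mu\sum_{j=i+1}^{\ell(k)}\|x^j-x^{j-1}\|.$$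
   Context: $\mathbb{X}$ is a finite-dimensional real inner product space with induced norm $\|\cdot\|$, $\overline{\mathbb{R}}=(-\infty,\infty]$, $\mathbb{N}=\{0,1,2,\dots\}$. For $k\in\mathbb{N}$, $\ell(k)$ is the largest index in $\arg\max\{\Phi(x^j): j=\max\{0,k-m\},\dots,k\}$. *)

(* Defs.v *)
From HB Require Import structures.
From mathcomp Require Import all_boot all_order all_algebra.
From mathcomp Require Import all_classical all_reals all_analysis.

Set Implicit Arguments.
Unset Strict Implicit.
Unset Printing Implicit Defensive.

Import Order.TTheory GRing.Theory Num.Theory.
Import numFieldNormedType.Exports.

Local Open Scope classical_set_scope.
Local Open Scope ring_scope.

(* The topology is the one of the norm.  The library has no inner product
   spaces: the inner product is a separate form [dot : {dot X for idfun}]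
   (bilinear, symmetric, positive definite) that induces the norm in the sense
   of [induces_norm].  The library's matrices carry the sup norm, hence are not
   Euclidean spaces in this sense when there is more than one entry. *)
#[short(type="normedVectType")]
HB.structure Definition NormedVector (R : numFieldType) :=
  {X of NormedModule R X & Vector R X}.

Definition induces_norm (R : realType) (X : normedVectType R)
    (dot : {dot X for idfun}) : Prop :=
  forall u : X, `|u| = Num.sqrt (dot u u).

Section ExtendedRealFunctions.
Local Open Scope ereal_scope.
Variables (R : realType) (X : Type).
Implicit Types Phi : X -> \bar R.

Definition edom Phi : set X := [set u | Phi u < +oo].

(* The first component makes Phi take its values in (-oo, +oo]. *)
Definition proper_efun Phi : Prop := (forall u, -oo < Phi u) /\ edom Phi !=set0.

Definition bounded_below Phi : Prop := exists c : R, forall u, c%:E <= Phi u.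

End ExtendedRealFunctions.

(* The window is max(0, k - m), ..., k: subtraction on nat is truncated. *)
Definition last_argmax (R : realType) (u : nat -> \bar R) (m k : nat) : nat :=
  (\max_(k - m <= j < k.+1 |
         all (fun i => u i <= u j)%E (index_iota (k - m) k.+1)) j)%N.

(* Main.v *)
Require Import Defs.
From HB Require Import structures.
From mathcomp Require Import all_boot all_order all_algebra.
From mathcomp Require Import all_classical all_reals all_analysis.
From mathcomp Require Import zify.

(** A maximiser over the window [k - m, k] has index at least [k - m]
    ([leq_last_argmax]), so for large [k] every index [i > l (k - 1)] is already
    in the range where the quadratic growth bound on one step holds.
    Telescoping that bound from [i] to [l k] gives
    [Phi (x (l k)) - Phi (x i) <= b / 2 * sum of squared steps], and a sum of
    squares of nonnegative numbers is at most the square of their sum. Taking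
    square roots ([sqrt_increment_le]) bounds the left-hand side by
    [sqrt (b / 2)] times the sum of the steps; this gives [mu], and adding the
    nonnegative multiple of [`|x i - x (i - 1)|] keeps the bound, for instance
    with [tau = 1 / 2]. *)

Set Implicit Arguments.
Unset Strict Implicit.
Unset Printing Implicit Defensive.

Import Order.TTheory GRing.Theory Num.Theory.
Import numFieldNormedType.Exports.

Local Open Scope classical_set_scope.
Local Open Scope ring_scope.

(** A big maximum over an empty index set would be 0; the bound thus amounts to
    the existence of a maximiser, which holds as the window is finite and
    contains [k]. *)
Lemma leq_last_argmax (R : realType) (u : nat -> \bar R) (m k : nat) :
  (k - m <= last_argmax u m k)%N.
Proof.
have kP : (k - m <= @ord_max k)%N by rewrite leq_subr.
case: (@Order.TotalTheory.arg_maxP _ _ _ (@ord_max k)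
         (fun j : 'I_k.+1 => (k - m <= j)%N) (fun j => u j) kP) => j kj jmax.
apply: (leq_trans kj); rewrite /last_argmax.
apply: (@leq_bigmax_seq _ _ _ (fun j => j) (val j)).
  by rewrite mem_index_iota kj ltn_ord.
apply/allP => i; rewrite mem_index_iota => /andP[ki ik].
exact: (jmax (Ordinal ik)).
Qed.

(** The cross terms of the expanded square are nonnegative. *)
Lemma sumr_sqr_le_sqr_sumr (R : realDomainType) (I : Type) (r : seq I)
    (F : I -> R) : (forall i, 0 <= F i) ->
  \sum_(i <- r) F i ^+ 2 <= (\sum_(i <- r) F i) ^+ 2.
Proof.
move=> F0; elim: r => [|i r IHr]; first by rewrite !big_nil expr0n.
rewrite !big_cons sqrrD -addrA lerD2l (le_trans IHr)// lerDr mulrn_wge0//.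
by rewrite mulr_ge0// sumr_ge0.
Qed.

(** Growth of [g] that is quadratic in each step of [x] becomes, after a square
    root, linear in the length of the whole path. The sign of [g n - g i] is
    free, since the square root of a negative number is 0. *)
Lemma sqrt_increment_le (R : realType) (V : normedModType R) (x : nat -> V)
    (g : nat -> R) (c : R) (i n : nat) : 0 <= c -> (i <= n)%N ->
  (forall j, (i <= j)%N -> g j.+1 - g j <= c * `|x j.+1 - x j| ^+ 2) ->
  Num.sqrt (g n - g i) <=
    Num.sqrt c * \sum_(i <= j < n) `|x j.+1 - x j|.
Proof.
move=> c0 le_in gx; set S := \sum_(_ <= _ < _) _.
have S0 : 0 <= S by apply: sumr_ge0.
rewrite -[S]ger0_norm// -sqrtr_sqr -sqrtrM// ler_wsqrtr//.
rewrite -telescope_sumr//.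
apply: (@le_trans _ _ (\sum_(i <= j < n) c * `|x j.+1 - x j| ^+ 2)).
  by apply: ler_sum_nat => j /andP[ij _]; exact: gx.
by rewrite -mulr_sumr ler_wpM2l// sumr_sqr_le_sqr_sumr.
Qed.

Theorem lemma4 (R : realType) (X : normedVectType R) (dot : {dot X for idfun})
    (hdot : induces_norm dot)
    (Phi : X -> \bar R) (hproper : proper_efun Phi)
    (hlsc : lower_semicontinuous Phi) (hbelow : bounded_below Phi)
    (m : nat) (a : R) (ha : 0 < a)
    (x : nat -> X) (hx : forall k, edom Phi (x k))
    (hdecr : exists (k1 : nat) (b : R), [/\ (m < k1)%N, 0 < b &
      forall k, (k1 <= k)%N ->
        (Phi (x k.+1) - Phi (x k) <= (b / 2 * `|x k.+1 - x k| ^+ 2)%:E)%E]) :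
  let l := last_argmax (fun k => Phi (x k)) m in
  exists (tau mu : R) (kbar : nat),
    [/\ 0 < tau < 1, 0 < mu, (m < kbar)%N &
      forall k i, (kbar <= k)%N -> (l (k - 1) + 1 <= i <= l k - 1)%N ->
        (sqrte (Phi (x (l k)) - Phi (x i)) <=
          (tau * Num.sqrt a * `|x i - x (i - 1)%N|
           + mu * \sum_(i + 1 <= j < (l k).+1) `|x j - x (j - 1)%N|)%:E)%E].
Proof.
case: hdecr => k1 [b [mk1 b0 hdecr]] l.
have b20 : 0 < b / 2 by rewrite divr_gt0.
have PhiE n : Phi (x n) = (fine (Phi (x n)))%:E.
  by rewrite fineK// fin_numElt (hproper.1 (x n)); exact: hx.
(* As [k - 1 - m <= l (k - 1) < i], taking [k > k1 + m] forces [k1 <= i]. *)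
exists 2^-1, (Num.sqrt (b / 2)), (k1 + m).+1; split.
- by rewrite invr_gt0 ltr0n invf_lt1// ltr1n.
- by rewrite sqrtr_gt0.
- by rewrite ltnS leq_addl.
move=> k i kk /andP[li il].
have k1i : (k1 <= i)%N.
  have := leq_last_argmax (fun n => Phi (x n)) m (k - 1); rewrite -/(l _).
  by lia.
have ilk : (i <= l k)%N by lia.
rewrite (PhiE (l k)) (PhiE i) -EFinB /= lee_fin addn1 big_add1 /=.
under eq_bigr do rewrite subn1 /=.
apply: ler_wpDl; first by rewrite !mulr_ge0// ?invr_ge0 ?sqrtr_ge0.
apply: (sqrt_increment_le (g := fun n => fine (Phi (x n)))) => [||j ij] //.
  exact: ltW.
rewrite -lee_fin EFinB -!PhiE; apply: hdecr.
exact: leq_trans ij.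
Qed.
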